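(* Let $q$ be an odd prime power, $t\ge 3$ an integer, $n=2t$, $m\in\mathbb{F}_{q^t}^*$, and $\sigma=q^J$ with $J\in\{1,\ldots,2t-1\}$, $\gcd(J,2t)=1$. Then the $q$-polynomial \[\varphi_{m,\sigma}=X^{\sigma^{t-1}}+X^{\sigma^{2t-1}}+m\left(X^{\sigma}-X^{\sigma^{t+1}}\right)\in\mathbb{F}_{q^{2t}}[X]\] is $\mathrm{R}$-$q^t$-partially scattered, i.e. for all $x,y\in\mathbb{F}_{q^{2t}}^*$, if $\varphi_{m,\sigma}(x)/x=\varphi_{m,\sigma}(y)/y$ and $x/y\in\mathbb{F}_{q^t}$, then $x/y\in\mathbb{F}_q$.
   Context: $q$-polynomials over $\mathbb{F}_{q^{2t}}$ are considered modulo $X^{q^{2t}}-X$ and identified with the corresponding $\mathbb{F}_q$-linear maps of $\mathbb{F}_{q^{2t}}$. *)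

(* Defs.v *)
From mathcomp Require Import all_boot all_order all_algebra all_field.

Set Implicit Arguments.
Unset Strict Implicit.
Unset Printing Implicit Defensive.

Import GRing.Theory.
Local Open Scope ring_scope.

(* A q-polynomial is an element of {poly L}, left unreduced: its linear map is
   x |-> f.[x], which depends only on f modulo X^(q^(2t)) - X.
   [phi t s m] is phi_{m,s}, where s is the natural number sigma = q^J. *)
Definition phi (F : finFieldType) (L : fieldExtType F) (t s : nat) (m : L) :
    {poly L} :=
  'X^(s ^ t.-1)%N + 'X^(s ^ (2 * t).-1)%N + m *: ('X^s - 'X^(s ^ t.+1)%N).

(* For #|F| = q, [L : K] = 2 and [K : F] = t this is R-q^t-partial
   scatteredness: K is the subfield F_{q^t} of L, and 1%VS is F_q. *)
Definition R_partially_scattered (F : finFieldType) (L : fieldExtType F)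
    (K : {subfield L}) (f : {poly L}) : Prop :=
  forall x y : L, x != 0 -> y != 0 ->
    f.[x] / x = f.[y] / y -> x / y \in K -> x / y \in 1%VS.

(* Main.v *)
(* Write r = x / y, a fixed point of sigma^t.  The equation phi(r y) = r phi(y)
   reads (sigma^(t-1) r - r) A + m (sigma r - r) B = 0, where
   A = sigma^(t-1) (y + sigma^t y) is fixed by sigma^t and
   B = sigma (y - sigma^t y) is negated by it.  Since q is odd, the summands,
   being respectively fixed and negated by sigma^t, both vanish.  As A and B
   cannot both be 0, r is fixed by sigma or by sigma^(t-1), hence by sigma, a
   generator of the Galois group. *)

Require Import Defs.
From mathcomp Require Import all_boot all_order all_algebra all_field.
From mathcomp Require Import ring.

Set Implicit Arguments.
Unset Strict Implicit.
Unset Printing Implicit Defensive.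

Import GRing.Theory.
Local Open Scope ring_scope.

Lemma expr_expn_fixed (R : pzSemiRingType) (x : R) (s k : nat) :
  x ^+ s = x -> x ^+ (s ^ k)%N = x.
Proof. by move=> xs; elim: k => // k IHk; rewrite expnSr exprM IHk. Qed.

(** Bezout in subtraction-free form, [gcdn a b + c * a = k * b]: replacing [x] by
    [x ^+ (q ^ (c * a))] turns the exponent into a power of [q ^ b]. *)
Lemma expr_expn_fixed_gcdn (R : pzSemiRingType) (x : R) (q a b : nat) :
  (0 < b)%N -> x ^+ (q ^ a)%N = x -> x ^+ (q ^ b)%N = x ->
  x ^+ (q ^ gcdn a b)%N = x.
Proof.
move=> b_gt0 xa xb; have [c _ /dvdnP[k def_kb]] := Bezoutr a b_gt0.
have xca : x ^+ (q ^ (c * a))%N = x.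
  by rewrite mulnC expnM; apply: expr_expn_fixed.
rewrite -[in LHS]xca -exprM -expnD addnC def_kb mulnC expnM.
exact: expr_expn_fixed.
Qed.

Section FiniteFieldExtension.

Variables (F : finFieldType) (L : fieldExtType F).

(** This is the side condition under which raising to the power [#|F| ^ k] is additive on [L]. *)
Lemma pchar_nat_cardX (k : nat) : [pchar L].-nat (#|F| ^ k)%N.
Proof.
have [p p_pr charFp] := finPcharP F.
rewrite (card_pprimeChar charFp) -expnM pnatX; apply/orP; left.
by rewrite pnatE // (pchar_lalg L).
Qed.

(** In characteristic 2, [#|F|] is a power of 2; being odd it would equal 1, but a field has at
    least two elements. *)
Lemma natr_odd_card_neq0 : odd #|F| -> 2%:R != 0 :> L.
Proof.
have [p p_pr charFp] := finPcharP F => F_odd; apply/negP => two0.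
have char2 : 2 \in [pchar F].
  by rewrite -(pchar_lalg L) inE /= two0.
move: F_odd; rewrite (card_pprimeChar char2) oddX orbF => /eqP F1.
by have := finNzRing_gt1 F; rewrite (card_pprimeChar char2) F1.
Qed.

End FiniteFieldExtension.

Theorem theorem2p2 (q t J : nat) (F : finFieldType) (L : fieldExtType F)
    (K : {subfield L}) (m : L)
    (q_odd : odd q) (cardF : #|F| = q) (t_ge3 : (3 <= t)%N)
    (dimL : \dim {:L} = (2 * t)%N) (dimK : \dim K = t)
    (m_in_K : m \in K) (m_neq0 : m != 0)
    (J_range : (1 <= J <= 2 * t - 1)%N) (J_coprime : coprime J (2 * t)) :
  R_partially_scattered K (phi t (q ^ J)%N m).
Proof.
move=> x y x0 y0 phi_xy r_in_K; set s := (q ^ J)%N in phi_xy.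
have t_gt0 : (0 < t)%N by apply: leq_trans t_ge3.
have s_gt0 : (0 < s)%N by rewrite expn_gt0 odd_gt0.
have two0 : 2%:R != 0 :> L by apply: natr_odd_card_neq0; rewrite cardF.
have sD k (a b : L) : (a + b) ^+ (s ^ k)%N = a ^+ (s ^ k)%N + b ^+ (s ^ k)%N.
  by apply: exprDn_pchar; rewrite /s -expnM -cardF pchar_nat_cardX.
have sN k (a : L) : (- a) ^+ (s ^ k)%N = - a ^+ (s ^ k)%N.
  by apply: exprNn_pchar; rewrite /s -expnM -cardF pchar_nat_cardX.
have sX k l (a : L) : (a ^+ (s ^ k)%N) ^+ (s ^ l)%N = a ^+ (s ^ (k + l))%N.
  by rewrite -exprM -expnD.
have qL (a : L) : a ^+ (q ^ (2 * t))%N = a.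
  by have := memvf a; rewrite Fermat's_little_theorem cardF dimL => /eqP.
have sL (a : L) : a ^+ (s ^ (2 * t))%N = a.
  by rewrite /s -expnM mulnC expnM; apply: expr_expn_fixed.
have sK (a : L) : a \in K -> a ^+ (s ^ t)%N = a.
  rewrite Fermat's_little_theorem cardF dimK => /eqP aK.
  by rewrite /s -expnM mulnC expnM; apply: expr_expn_fixed.
set r := x / y in r_in_K *; have def_x : x = r * y by rewrite divfK.
clearbody r.
have rt := sK _ r_in_K; have mt := sK _ m_in_K.
suff rs : r ^+ s = r.
  rewrite Fermat's_little_theorem cardF dimv1; apply/eqP.
  (* The exponent 1 is [gcdn J (2 * t)], and [r] is fixed by the powers [q ^ J] and
     [q ^ (2 * t)]. *)
  by rewrite -[X in (q ^ X)%N](eqP J_coprime) expr_expn_fixed_gcdn ?muln_gt0.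
have /eqP := phi_xy; rewrite eqr_div // => /eqP {phi_xy}.
rewrite /phi !(hornerD, hornerZ, hornerN, hornerXn) def_x !(exprMn _ r).
(* Since [t > 0], [2t - 1 = t + (t - 1)], and the factor [s ^ t] acts trivially on [r]. *)
have r_2t1 : r ^+ (s ^ (2 * t).-1)%N = r ^+ (s ^ t.-1)%N.
  rewrite -[in RHS]rt sX; congr (_ ^+ (s ^ _)).
  by rewrite mul2n -addnn -!subn1 addnBA.
have r_t1 : r ^+ (s ^ t.+1)%N = r ^+ s by rewrite expnS mulnC exprM rt.
rewrite r_2t1 r_t1.
set r1 := r ^+ s; set r' := r ^+ (s ^ t.-1)%N.
set u := y ^+ (s ^ t.-1)%N; set u' := y ^+ (s ^ (2 * t).-1)%N.
set v := y ^+ s; set v' := y ^+ (s ^ t.+1)%N => phi_xy.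
(* The cross-multiplied equation, with everything on one side, is [y] times this one; [u + u'] is A
   and [v - v'] is B. *)
have E : (r' - r) * (u + u') + m * ((r1 - r) * (v - v')) = 0.
  apply: (mulIf y0); rewrite mul0r.
  move/eqP: phi_xy; rewrite -subr_eq0 => /eqP <-; ring.
have r1t : r1 ^+ (s ^ t)%N = r1 by rewrite /r1 exprAC rt.
have r't : r' ^+ (s ^ t)%N = r' by rewrite /r' exprAC rt.
have ut : u ^+ (s ^ t)%N = u'.
  rewrite /u sX; congr (_ ^+ (s ^ _)).
  by rewrite mul2n -addnn -!subn1 addnC addnBA.
have u't : u' ^+ (s ^ t)%N = u by rewrite -ut sX addnn -mul2n sL.
have vt : v ^+ (s ^ t)%N = v' by rewrite /v -exprM -expnS.
have v't : v' ^+ (s ^ t)%N = v by rewrite -vt sX addnn -mul2n sL.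
(* Raising [E] to the power [s ^ t] swaps [u] with [u'] and [v] with [v'], and fixes [m], [r], [r1]
   and [r']. *)
have E' : (r' - r) * (u + u') - m * ((r1 - r) * (v - v')) = 0.
  have := congr1 (fun z => z ^+ (s ^ t)%N) E; rewrite /= expr0n.
  rewrite !(sD, exprMn, sN) mt r1t r't rt ut u't vt v't.
  by rewrite expn_eq0 eqn0Ngt s_gt0 /= mulr0n => <-; ring.
have A0 : (r' - r) * (u + u') = 0.
  apply: (mulfI two0); rewrite mulr0 -[RHS](addr0 0).
  by rewrite -[X in _ = X + _]E -[X in _ = _ + X]E'; ring.
have B0 : (r1 - r) * (v - v') = 0.
  by apply: (mulfI m_neq0); rewrite mulr0 -[RHS]E A0 add0r.
move/eqP: A0; rewrite mulf_eq0 subr_eq0 => /orP[/eqP r'r | /eqP uu0].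
  (* Here [r ^+ s = r' ^+ s = r ^+ (s ^ t) = r]. *)
  by rewrite /r1 -[in LHS]r'r /r' -exprM -expnSr prednK.
move/eqP: B0; rewrite mulf_eq0 !subr_eq0 => /orP[/eqP // | /eqP vv'].
(* The power [s ^ (2t - 1)] inverts the power [s]; it carries [v = v'] back to [y]. *)
have yt : y ^+ (s ^ t)%N = y.
  have := congr1 (fun z => z ^+ (s ^ (2 * t).-1)%N) vv'.
  have vy : v ^+ (s ^ (2 * t).-1)%N = y.
    by rewrite -exprM -expnS prednK ?muln_gt0 // sL.
  by rewrite /= -vt (exprAC v) vy.
(* Now [u + u' = 0] becomes [2u = 0], impossible as [u] is a power of [y != 0]. *)
have uu' : u' = u by rewrite -ut /u exprAC yt.
move/eqP: uu0; rewrite uu' -mulr2n -mulr_natl mulf_eq0 (negPf two0) /=.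
by rewrite expf_eq0 (negPf y0) andbF.
Qed.
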